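(* Let $L_\psi>0$ and let $\phi:\mathbb{R}^N\to\mathbb{R}\cup\{+\infty\}$ be a proper, lower semicontinuous, $\rho$-weakly convex function with $\rho=1-\frac1{L_\psi}$ and with prox-bound $\lambda_\phi>1$. Let $g_c:\mathbb{R}^N\to\mathbb{R}^N$ be an $\epsilon$-type (c) approximation of $\mathrm{prox}_\phi$. Then $$\forall x\in\mathbb{R}^N,\quad \|g_c(x)-\mathrm{prox}_\phi(x)\|\le\sqrt{\frac{\epsilon}{1-\rho}} .$$
   Context: $\phi$ is $\rho$-weakly convex if $\phi+\frac{\rho}{2}\|\cdot\|^2$ is convex. The prox-bound $\lambda_\phi$ is the supremum of all $\lambda>0$ such that $\inf_{x}\{\phi(x)+\frac1{2\lambda}\|x-y\|^2\}>-\infty$ for some $y\in\mathbb{R}^N$. The proximal operator is $\mathrm{prox}_\phi(y)=\operatorname{argmin}_{x\in\mathbb{R}^N}\{\phi(x)+\frac12\|x-y\|^2\}$. For $\bar x\in\mathrm{dom}\,\phi$, the $(\rho,\epsilon)$-subdifferential is $$\partial_\epsilon^\rho\phi(\bar x)=\left\{v\in\mathbb{R}^N : \langle v,x-\bar x\rangle\le\phi(x)-\phi(\bar x)+\tfrac{\rho}{2}\|x-\bar x\|^2+\epsilon\ \text{ for all }x\in\mathbb{R}^N\right\}.$$ $g_c$ is an $\epsilon$-type (c) approximation of $\mathrm{prox}_\phi$ if $y-g_c(y)\in\partial_\epsilon^\rho\phi(g_c(y))$ for all $y\in\mathbb{R}^N$ (in particular $g_c(y)\in\mathrm{dom}\,\phi$).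 *)

(* Defs.v *)
From HB Require Import structures.
From mathcomp Require Import all_boot all_order all_algebra.
From mathcomp Require Import all_classical all_reals all_analysis.

Set Implicit Arguments.
Unset Strict Implicit.
Unset Printing Implicit Defensive.

Import Order.TTheory GRing.Theory Num.Theory.
Import numFieldNormedType.Exports.

Local Open Scope classical_set_scope.
Local Open Scope ring_scope.
Local Open Scope ereal_scope.

Definition dotv (R : realType) (N : nat) (u v : 'rV[R]_N) : R :=
  (\sum_(i < N) u ord0 i * v ord0 i)%R.

(* The library's norm [`| v |] on row vectors is the sup norm. *)
Definition enorm (R : realType) (N : nat) (v : 'rV[R]_N) : R :=
  Num.sqrt (dotv v v).

Definition edom (R : realType) (N : nat) (phi : 'rV[R]_N -> \bar R) :
    set 'rV[R]_N :=
  [set x | phi x < +oo].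

Definition proper_fun (R : realType) (N : nat) (phi : 'rV[R]_N -> \bar R) :
    Prop :=
  (forall x, -oo < phi x) /\ edom phi !=set0.

(* Meant for functions avoiding -oo, for which no sum below is of the
   form +oo + -oo; the convention 0 * +oo = 0 makes t = 0 and t = 1 harmless. *)
Definition econvex (R : realType) (N : nat) (f : 'rV[R]_N -> \bar R) : Prop :=
  forall (x y : 'rV[R]_N) (t : R), (0 <= t <= 1)%R ->
    f (t *: x + (1 - t) *: y)%R <= t%:E * f x + (1 - t)%:E * f y.

Definition weakly_convex (R : realType) (N : nat) (rho : R)
    (phi : 'rV[R]_N -> \bar R) : Prop :=
  econvex (fun x => phi x + (rho / 2 * enorm x ^+ 2)%:E).

Definition prox_bound (R : realType) (N : nat) (phi : 'rV[R]_N -> \bar R) :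
    \bar R :=
  ereal_sup [set lambda%:E | lambda in [set lambda : R | (0 < lambda)%R /\
    exists y : 'rV[R]_N,
      -oo < ereal_inf (range (fun x : 'rV[R]_N =>
              phi x + ((2 * lambda)^-1 * enorm (x - y) ^+ 2)%:E))]].

Definition argmin (T : Type) (R : realType) (f : T -> \bar R) : set T :=
  [set x | forall z, f x <= f z].

Definition prox (R : realType) (N : nat) (phi : 'rV[R]_N -> \bar R)
    (y : 'rV[R]_N) : set 'rV[R]_N :=
  argmin (fun x => phi x + (2^-1 * enorm (x - y) ^+ 2)%:E).

(* Empty when xbar is outside the domain of phi. *)
Definition subdiff (R : realType) (N : nat) (rho eps : R)
    (phi : 'rV[R]_N -> \bar R) (xbar : 'rV[R]_N) : set 'rV[R]_N :=
  [set v | edom phi xbar /\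
    forall x : 'rV[R]_N,
      (dotv v (x - xbar))%:E <=
        phi x - phi xbar + (rho / 2 * enorm (x - xbar) ^+ 2)%:E + eps%:E].

Definition type_c_approx (R : realType) (N : nat) (rho eps : R)
    (phi : 'rV[R]_N -> \bar R) (g : 'rV[R]_N -> 'rV[R]_N) : Prop :=
  forall y, subdiff rho eps phi (g y) (y - g y)%R.

(* Main.v *)
Require Import Defs.
From HB Require Import structures.
From mathcomp Require Import all_boot all_order all_algebra.
From mathcomp Require Import all_classical all_reals all_analysis.
From mathcomp Require Import ring lra.

Import Order.TTheory GRing.Theory Num.Theory.
Import numFieldNormedType.Exports.

Local Open Scope classical_set_scope.
Local Open Scope ring_scope.

(** Fix [y] and let [F x = phi x + |x - y|^2 / 2] be the function that the
    proximal operator minimizes; put [mu = 1 - rho], which is positive because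
    it equals [L_psi^-1].  Expanding the squares in the subgradient inequality
    satisfied by [y - g] at [g = g_c y] turns it into
      [F g + mu / 2 * |x - g|^2 <= F x + eps]      for all [x]
    ([subdiff_growth]).  In other words [F] has, up to [eps], quadratic growth
    around [g].

    This bound is used twice.  It forces [F x >= F g] outside a box around
    [g]; as [F] is lower semicontinuous, it attains its minimum on the compact
    box, hence on the whole space ([lsc_growth_argmin]).  At the resulting
    minimizer [p] it reads [F g + mu / 2 * |p - g|^2 <= F p + eps].

    On the other hand [F] is [mu]-strongly convex, so it has exact quadratic
    growth around its minimizer: [F p + mu / 2 * |x - p|^2 <= F x] for all [x]
    ([prox_growth]).  This gives uniqueness of [p]; at [x = g], added to the
    previous inequality, it gives [mu * |p - g|^2 <= eps].  *)

(** * Lower semicontinuous functions *)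

Lemma EFin_between {R : realFieldType} (x y : \bar R) :
  (x < y)%E -> exists r : R, (x < r%:E < y)%E.
Proof.
case: x => [x| |]; case: y => [y| |] //=; rewrite ?ltNyr ?ltry => xy //.
- by exists ((x + y) / 2); rewrite !lte_fin in xy *; lra.
- by exists (x + 1); rewrite lte_fin ltry; lra.
- by exists (y - 1); rewrite lte_fin ltNyr; lra.
- by exists 0; rewrite ltNyr ltry.
Qed.

Lemma lower_semicontinuous_addr_continuous {X : topologicalType}
    {R : realType} (f : X -> \bar R) (q : X -> R) :
  lower_semicontinuous f -> continuous q ->
  lower_semicontinuous (fun x => f x + (q x)%:E)%E.
Proof.
move=> lscf cq x a; rewrite -lteBlDr// => /EFin_between[b /andP[ab bf]].
have [V xV Vb] := lscf _ _ bf.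
have xq : nbhs x [set z | a - b < q z].
  by apply: (cvgr_gt _ (cq x)); rewrite -EFinB lte_fin in ab; lra.
exists (V `&` [set z | a - b < q z]); first exact: filterI.
move=> z [/Vb bfz /= abz]; rewrite -lteBlDr//; apply: le_lt_trans bfz.
by rewrite -EFinB lee_fin; lra.
Qed.

(** The sublevel sets of [f] at its own values form a filter base on [K];
    lower semicontinuity puts each of its cluster points in all of them. *)
Lemma compact_lower_semicontinuous_min {X : topologicalType} {R : realType}
    (K : set X) (f : X -> \bar R) :
  compact K -> K !=set0 -> lower_semicontinuous f ->
  exists2 p, K p & forall z, K z -> (f p <= f z)%E.
Proof.
move=> cK [x0 Kx0] lscf.
pose B z := [set x | K x /\ (f x <= f z)%E].
have BF : Filter (filter_from K B).
  apply: filter_from_filter; first by exists x0.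
  move=> i j Ki Kj; have [fij|/ltW fji] := leP (f i) (f j).
  - by exists i => // x [Kx fxi]; do !split=> //; apply: le_trans fij.
  - by exists j => // x [Kx fxj]; do !split=> //; apply: le_trans fji.
have BPF : ProperFilter (filter_from K B).
  by apply: filter_from_proper => z Kz; exists z; split.
have BK : filter_from K B K by exists x0 => // x [].
have [p [Kp clp]] := cK _ BPF BK.
exists p => // z Kz; rewrite leNgt; apply/negP => /EFin_between[r /andP[zr rp]].
have [V pV Vr] := lscf _ _ rp.
have Bz : filter_from K B (B z) by exists z.
have [x [[_ xz] /Vr rx]] := clp _ _ Bz pV.
by have := lt_trans (lt_le_trans rx xz) zr; rewrite ltxx.
Qed.

(** * The Euclidean norm *)

Section EuclideanNorm.
Context {R : realType} {N : nat}.
Implicit Types u v x y z : 'rV[R]_N.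

Lemma dotv_ge0 v : 0 <= dotv v v.
Proof. by apply: sumr_ge0 => i _; rewrite -expr2 sqr_ge0. Qed.

Lemma enorm_sqr v : enorm v ^+ 2 = dotv v v.
Proof. by rewrite sqr_sqrtr// dotv_ge0. Qed.

Lemma enorm_sqrB x y : enorm (x - y) ^+ 2 = enorm (y - x) ^+ 2.
Proof.
by rewrite !enorm_sqr; apply: eq_bigr => i _; rewrite !mxE; ring.
Qed.

Lemma enorm_sqr_eq0 v : enorm v ^+ 2 = 0 -> v = 0.
Proof.
rewrite enorm_sqr => /psumr_eq0P v0; apply/rowP => i; rewrite mxE.
have /eqP : v ord0 i * v ord0 i = 0.
  by apply: v0 => // j _; rewrite -expr2 sqr_ge0.
by rewrite mulf_eq0 orbb => /eqP.
Qed.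

Lemma coord_sqr_le_enorm v i : v ord0 i ^+ 2 <= enorm v ^+ 2.
Proof.
rewrite enorm_sqr /dotv (bigD1 i)//= -expr2 lerDl.
by apply: sumr_ge0 => j _; rewrite -expr2 sqr_ge0.
Qed.

Lemma enorm_sqr_continuous y : continuous (fun x => enorm (x - y) ^+ 2).
Proof.
under eq_fun do rewrite enorm_sqr /dotv.
apply: continuous_big => [|i _]; first exact: add_continuous.
under eq_fun do rewrite !mxE.
have ci : continuous (fun x : 'rV[R]_N => x ord0 i - y ord0 i).
  move=> x; apply: (@cvgB _ _ _ (nbhs x)); last exact: cvg_cst.
  exact: coord_continuous.
by move=> x; apply: (@cvgM _ _ (nbhs x)); exact: ci.
Qed.

Lemma enorm_sqr_law_of_cosines x y z :
  enorm (z - y) ^+ 2 =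
  enorm (x - y) ^+ 2 + enorm (z - x) ^+ 2 - 2 * dotv (y - x) (z - x).
Proof.
rewrite !enorm_sqr /dotv mulr_sumr -big_split/= -sumrB.
by apply: eq_bigr => i _; rewrite !mxE; ring.
Qed.

(** The last term is the exact convexity defect of the squared norm: it is the
    source of the strong convexity of the proximal objective. *)
Lemma enorm_sqr_convex_comb x z (t : R) :
  enorm (t *: z + (1 - t) *: x) ^+ 2 =
  t * enorm z ^+ 2 + (1 - t) * enorm x ^+ 2 - t * (1 - t) * enorm (z - x) ^+ 2.
Proof.
rewrite !enorm_sqr /dotv !mulr_sumr -big_split/= -sumrB.
by apply: eq_bigr => i _; rewrite !mxE; ring.
Qed.

End EuclideanNorm.

(** * Quadratic growth of the proximal objective *)

Definition prox_objective {R : realType} {N : nat} (phi : 'rV[R]_N -> \bar R)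
    (y x : 'rV[R]_N) : \bar R :=
  (phi x + (2^-1 * enorm (x - y) ^+ 2)%:E)%E.

Section QuadraticGrowth.
Context {R : realType} {N : nat}.
Implicit Types (phi F : 'rV[R]_N -> \bar R) (x y z p g : 'rV[R]_N).

Lemma prox_objective_lower_semicontinuous phi y :
  lower_semicontinuous phi -> lower_semicontinuous (prox_objective phi y).
Proof.
move=> lsc; apply: lower_semicontinuous_addr_continuous => // x.
by apply: (@cvgM _ _ (nbhs x)); [exact: cvg_cst|exact: enorm_sqr_continuous].
Qed.

(** The square in the proximal objective absorbs the linear term of the
    subgradient inequality, by the law of cosines; what remains of
    [|x - g|^2 / 2] after paying for the weak convexity is the growth term. *)
Lemma subdiff_growth rho eps phi y g : (forall x, -oo < phi x)%E ->
  subdiff rho eps phi g (y - g) ->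
  forall x, (prox_objective phi y g + ((1 - rho) / 2 * enorm (x - g) ^+ 2)%:E
             <= prox_objective phi y x + eps%:E)%E.
Proof.
move=> phiNy [/= gdom gsub] x; have := gsub x.
rewrite /prox_objective (enorm_sqr_law_of_cosines g y x).
move: gdom (phiNy g) (phiNy x); rewrite /edom /=.
case: (phi g) => [a| |]//; case: (phi x) => [b| |]//= _ _ _;
  last by move=> _; exact: leey.
by rewrite -!(EFinD, EFinB, EFinN) !lee_fin; lra.
Qed.

(** The growth bound keeps [F] above [F g] outside a bounded box around [g],
    so a minimizer over the compact box is a global one. *)
Lemma lsc_growth_argmin F g (mu eps : R) : 0 < mu ->
  lower_semicontinuous F -> (-oo < F g < +oo)%E ->
  (forall x, F g + (mu / 2 * enorm (x - g) ^+ 2)%:E <= F x + eps%:E)%E ->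
  argmin F !=set0.
Proof.
move=> mu0 lscF Fg growth.
(* Half the side of a box outside which the growth term exceeds [eps] *)
pose r := Num.sqrt (2 * eps / mu).
pose K := [set x : 'rV[R]_N |
  forall i, `[g ord0 i - r, g ord0 i + r]%classic (x ord0 i)].
have r0 : 0 <= r by exact: sqrtr_ge0.
have Kg : K g by move=> i /=; rewrite in_itv /=; lra.
have cK : compact K.
  apply: (rV_compact (A := fun i => `[g ord0 i - r, g ord0 i + r]%classic)).
  by move=> i; exact: segment_compact.
have [p Kp pmin] :=
  compact_lower_semicontinuous_min _ _ cK (ex_intro _ g Kg) lscF.
exists p => z; have [/pmin//|] := pselect (K z).
move=> /existsNP[i /negP]; rewrite in_itv /= => zi.
apply: le_trans (pmin _ Kg) _.
have zgr : r ^+ 2 <= enorm (z - g) ^+ 2.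
  apply: le_trans (coord_sqr_le_enorm _ i); rewrite !mxE.
  by move: zi; rewrite negb_and -!ltNge => /orP[] h; nra.
have : 2 * eps / mu <= r ^+ 2.
  have [e0|/ltW e0] := leP 0 (2 * eps / mu); first by rewrite sqr_sqrtr.
  by apply: le_trans e0 _; exact: sqr_ge0.
move=> /le_trans/(_ zgr); rewrite ler_pdivrMr// => epsle.
move: (growth z) Fg; case: (F g) => [a| |]//; case: (F z) => [b| |]//= + _.
  by rewrite -!EFinD !lee_fin; lra.
by move=> _; rewrite leey.
Qed.

(** Comparing [p] with the point [t *: x + (1 - t) *: p] of the segment from
    [p] to [x] yields [F p + (1 - t) * mu / 2 * |x - p|^2 <= F x]; the claim is
    the limit [t --> 0]. *)
Lemma prox_growth rho phi y p : (forall x, -oo < phi x)%E ->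
  weakly_convex rho phi -> edom phi p -> prox phi y p ->
  forall x, (prox_objective phi y p + ((1 - rho) / 2 * enorm (x - p) ^+ 2)%:E
             <= prox_objective phi y x)%E.
Proof.
move=> phiNy wcvx pdom pmin x; rewrite /prox_objective.
have [phix|] := ltP (phi x) +oo%E; last first.
  by rewrite leye_eq => /eqP ->; rewrite leey.
have [b pb] : exists b, phi p = b%:E.
  by move: pdom (phiNy p); rewrite /edom/=; case: (phi p) => // b; exists b.
have [a xa] : exists a, phi x = a%:E.
  by move: phix (phiNy x); case: (phi x) => // a; exists a.
rewrite xa pb -!EFinD lee_fin.
set M := _ * enorm (x - p) ^+ 2.
set A := _ + 2^-1 * enorm (x - y) ^+ 2.
set B := b + _.
have seg t : 0 < t <= 1 -> B + (1 - t) * M <= A.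
  move=> /andP[t0 t1].
  have := wcvx x p t; rewrite t1 ltW// => /(_ isT).
  have := pmin (t *: x + (1 - t) *: p); rewrite /= /prox.
  move: (phiNy (t *: x + (1 - t) *: p)).
  rewrite /= xa pb -!EFinD.
  have -> : t *: x + (1 - t) *: p - y = t *: (x - y) + (1 - t) *: (p - y).
    by apply/rowP => i; rewrite !mxE; ring.
  rewrite !enorm_sqr_convex_comb.
  have -> : x - y - (p - y) = x - p by apply/rowP => i; rewrite !mxE; ring.
  case: (phi _) => [c| |]// _; rewrite -!EFinD !lee_fin => minc cvxc.
  rewrite -(ler_pM2l t0) /A /B /M.
  lra.
rewrite leNgt; apply/negP => AB.
have BA : B <= A by have := seg 1; rewrite ltr01 lexx subrr mul0r addr0; exact.
have M0 : 0 < M by lra.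
(* [t * M] is half of the assumed defect [B + M - A] *)
pose t := (B + M - A) / (2 * M).
have tM : t * M = (B + M - A) / 2 by rewrite /t; field; rewrite gt_eqF.
have t01 : 0 < t <= 1.
  by apply/andP; split; [apply: divr_gt0|rewrite ler_pdivrMr]; lra.
by have := seg t t01; rewrite mulrBl mul1r tM; lra.
Qed.

End QuadraticGrowth.

(** * The distance to the proximal point *)

Theorem proposition9 (R : realType) (N : nat) (L_psi rho eps : R)
  (phi : 'rV[R]_N -> \bar R) (g_c : 'rV[R]_N -> 'rV[R]_N)
  (L_psi_gt0 : 0 < L_psi)
  (phi_proper : proper_fun phi)
  (phi_lsc : lower_semicontinuous phi)
  (rhoE : rho = 1 - L_psi^-1)
  (phi_weakly_convex : weakly_convex rho phi)
  (phi_prox_bound : (1%:E < prox_bound phi)%E)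
  (g_c_approx : type_c_approx rho eps phi g_c) :
  forall x : 'rV[R]_N, exists p : 'rV[R]_N,
    prox phi x = [set p] /\
    enorm (g_c x - p) <= Num.sqrt (eps / (1 - rho)).
Proof.
move=> y; set g := g_c y.
have [phiNy _] := phi_proper.
have mu0 : 0 < 1 - rho by rewrite rhoE opprB addrC subrK invr_gt0.
have gsub : subdiff rho eps phi g (y - g) := g_c_approx y.
have ggrowth := subdiff_growth _ _ _ _ _ phiNy gsub.
have Fg_fin : (-oo < prox_objective phi y g < +oo)%E.
  case: gsub => + _; move: (phiNy g); rewrite /edom/= /prox_objective.
  by case: (phi g) => // a _ _; rewrite -EFinD ltNyr ltry.
have [p pmin] : prox phi y !=set0.
  apply: lsc_growth_argmin _ _ _ _ mu0 _ Fg_fin ggrowth.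
  exact: prox_objective_lower_semicontinuous.
have pdom q : prox phi y q -> edom phi q.
  move=> /(_ g) qg; have /andP[_] := Fg_fin.
  move=> /(le_lt_trans qg); rewrite /edom/=.
  by case: (phi q) => [c| |]//= _; rewrite ?ltry ?ltNyr.
have Fp_fin : (-oo < prox_objective phi y p < +oo)%E.
  have := pdom _ pmin; move: (phiNy p); rewrite /edom/= /prox_objective.
  by case: (phi p) => // a _ _; rewrite -EFinD ltNyr ltry.
have pgrowth := prox_growth _ _ _ _ phiNy phi_weakly_convex (pdom _ pmin) pmin.
exists p; split.
  apply/seteqP; split=> [q qmin|q ->//] /=.
  apply/eqP; rewrite -subr_eq0; apply/eqP/enorm_sqr_eq0.
  have := le_trans (pgrowth q) (qmin p); rewrite -/(prox_objective phi y p).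
  move: Fp_fin; case: (prox_objective phi y p) => [c| |]//= _.
  rewrite -EFinD lee_fin gerDl pmulr_rle0 ?divr_gt0// => qp.
  by apply: le_anti; rewrite qp sqr_ge0.
rewrite -[enorm _]ger0_norm ?sqrtr_ge0// -sqrtr_sqr ler_wsqrtr// ler_pdivlMr//.
have := ggrowth p; have := pgrowth g; rewrite (enorm_sqrB p g).
move: Fg_fin Fp_fin; case: (prox_objective phi y p) => [c| |]//=.
case: (prox_objective phi y g) => [d| |]//= _ _.
by rewrite -!EFinD !lee_fin; lra.
Qed.
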